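(* For every $\epsilon > 0$ and all sufficiently large $n$, every randomized algorithm in the LOCAL model which, on the $n$-node path $P_n$ with a uniformly random labelling, outputs an independent set with expected approximation factor at most $1+\epsilon$ for Maximum Independent Set requires $\Omega(\frac{1}{\epsilon})$ rounds.
   Context: $P_n$ is the path with vertices $v_1,\dots,v_n$ and edges $v_iv_{i+1}$. Each node $v_i$ receives a unique label $\ell(v_i)$, where $\ell$ is chosen uniformly at random among all bijections $V \to \{1,\dots,n\}$. In the LOCAL model, each node initially knows its label and its neighbors; computation proceeds in synchronous rounds in which every node performs unlimited local computation (possibly using private random bits) and sends messages of unbounded size to its neighbors; at termination each node knows whether it is in the output independent set $I$. Having expected approximation factor at most $1+\epsilon$ means $(1+\epsilon)\,\mathbb{E}|I| \ge \alpha(P_n) = \lceil n/2 \rceil$, where the expectation is over the random bits of the algorithm and the random labelling. *)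

(* Defs.v *)
From HB Require Import structures.
From mathcomp Require Import all_boot all_order all_algebra all_fingroup.
From mathcomp Require Import all_classical all_reals all_analysis.

Set Implicit Arguments.
Unset Strict Implicit.
Unset Printing Implicit Defensive.

Import Order.TTheory GRing.Theory Num.Theory.

Local Open Scope classical_set_scope.
Local Open Scope ring_scope.

Section Graphs.
Variables (V : finType) (e : rel V).

Definition independent (I : {set V}) : bool :=
  [forall u in I, forall v in I, ~~ e u v].

Definition alpha : nat := (\max_(I : {set V} | independent I) #|I|)%N.

End Graphs.

Definition path_edge (n : nat) : rel 'I_n :=
  fun u v => (u.+1 == v :> nat) || (v.+1 == u :> nat).

(* A node is given its own label, the set of labels of its neighbors (as a
   predicate) and its private infinite stream of random bits; nodes have no
   other identity. Neighbors are addressed through their labels: [send st x] is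
   the message sent to the neighbor labelled x, and the inbox passed to
   [receive] maps x to [Some m] when a neighbor labelled x sent m, and to
   [None] when no neighbor has label x. *)
Record local_algorithm := LocalAlgorithm {
  state : Type;
  message : Type;
  init : nat -> pred nat -> (nat -> bool) -> state;
  send : state -> nat -> message;
  receive : state -> (nat -> option message) -> state;
  output : state -> bool
}.

Section Execution.
Variables (V : finType) (e : rel V) (A : local_algorithm).
Variables (lab : V -> nat) (bits : V -> nat -> bool).

Definition neighbor_labels (v : V) : pred nat :=
  fun x => [exists u, e v u && (lab u == x)].

(* With injective labels at most one neighbor u of v has label x. *)
Definition inbox (st : V -> state A) (v : V) (x : nat) : option (message A) :=
  omap (fun u => send (st u) (lab v)) [pick u | e v u && (lab u == x)].

Fixpoint run (t : nat) : V -> state A :=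
  if t is t'.+1 then fun v => receive (run t' v) (inbox (run t') v)
  else fun v => init A (lab v) (neighbor_labels v) (bits v).

Definition output_set (T : nat) : {set V} := [set v | output (run T v)]%SET.

End Execution.

(* A permutation s of 'I_n stands for the bijection v |-> (s v).+1 onto
   {1, ..., n}. *)
Definition label_of (n : nat) (s : {perm 'I_n}) (v : 'I_n) : nat := (s v).+1.

Definition path_output (n : nat) (A : local_algorithm) (T : nat)
    (s : {perm 'I_n}) (bits : 'I_n -> nat -> bool) : {set 'I_n} :=
  output_set (@path_edge n) A (label_of s) bits T.

(* Product sigma-algebra on the bit assignments of the n nodes. *)
Definition measurable_bits (n : nat) : set_system ('I_n -> nat -> bool) :=
  <<s [set C | exists v k, C = [set bits : 'I_n -> nat -> bool | bits v k]] >>.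

(* Each node's decision is a measurable function of the random bits, so that
   its probability is determined by the law of the bits. *)
Definition measurable_output (n : nat) (A : local_algorithm) (T : nat) : Prop :=
  forall (s : {perm 'I_n}) (v : 'I_n),
    @measurable_bits n [set bits | v \in path_output A T s bits].

(* The labelling L is uniform, the bits (b v k) are fair, and L and all the
   bits are mutually independent: on every cylinder event the joint law is the
   product law. *)
Definition uniform_labelling_and_bits (R : realType) (d : measure_display)
    (W : measurableType d) (P : probability W R) (n : nat)
    (L : W -> {perm 'I_n}) (b : W -> 'I_n -> nat -> bool) : Prop :=
  [/\ forall s, measurable [set w | L w = s],
      forall v k, measurable [set w | b w v k] &
      forall (s : {perm 'I_n}) (K : nat) (a : 'I_n -> nat -> bool),
        P [set w | L w = s /\ forall v k, (k < K)%N -> b w v k = a v k] =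
        ((n`!)%:R^-1 * 2^-1 ^+ (n * K))%:E].

Definition expected_size (R : realType) (d : measure_display)
    (W : measurableType d) (P : probability W R) (n : nat)
    (I : W -> {set 'I_n}) : \bar R :=
  'E_P[fun w => (#|I w|)%:R].

Definition expected_approx_factor_le (R : realType) (d : measure_display)
    (W : measurableType d) (P : probability W R) (n : nat)
    (I : W -> {set 'I_n}) (r : R) : Prop :=
  (((alpha (@path_edge n))%:R)%:E <= r%:E * expected_size P I)%E.

(* Main.v *)
(** In an independent set of the path at most one end of each edge is chosen, so
    2|I| falls short of n by the number of edges with no end chosen, up to an end
    effect; along a segment without such edges the chosen nodes alternate. Let u, v
    be nodes at even distance 2T+4. The views after T rounds of u and v, and of u
    and v+1, cover disjoint segments of the path; since the labels are exchangeable
    and the bits independent, the events "u and v agree" and "u and v+1 agree" have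
    the same probability. Alternation throughout [u, v+1] would make the first
    happen and the second fail, so in expectation every block of 2T+5 consecutive
    edges contains at least 1/2 edge with no end chosen, a loss of order n/T. *)

Require Import Defs.
From HB Require Import structures.
From mathcomp Require Import all_boot all_order all_algebra all_fingroup.
From mathcomp Require Import all_classical all_reals all_analysis.
From mathcomp Require Import measurable_realfun zify lra.

Set Implicit Arguments.
Unset Strict Implicit.
Unset Printing Implicit Defensive.

Import Order.TTheory GRing.Theory Num.Theory.

Local Open Scope classical_set_scope.
Local Open Scope ring_scope.

Section Locality.
Variables (V V' : finType) (e : rel V) (e' : rel V').
Variables (f : V -> V') (g : V' -> V).
Hypothesis gK : cancel g f.

Fixpoint edge_preserving_on_ball (t : nat) (v : V) : Prop :=
  (forall y, e' (f v) (f y) = e v y) /\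
  (if t is t'.+1 then forall y, e v y -> edge_preserving_on_ball t' y else True).

Lemma edge_preserving_on_ballW (t : nat) (v : V) :
  edge_preserving_on_ball t.+1 v -> edge_preserving_on_ball t v.
Proof.
elim: t v => [v []//|t IH v [ev nv]].
by split => // y vy; apply: IH; exact: nv.
Qed.

Variables (A : local_algorithm) (lab : V -> nat) (lab' : V' -> nat).
Variables (bits : V -> nat -> bool) (bits' : V' -> nat -> bool).
Hypotheses (lab_inj : injective lab) (lab'E : forall x, lab' (f x) = lab x).
Hypothesis bits'E : forall x, bits' (f x) = bits x.

Lemma neighbor_labels_transport (v : V) :
  edge_preserving_on_ball 0 v ->
  neighbor_labels e' lab' (f v) = neighbor_labels e lab v.
Proof.
move=> [ev _]; apply: funext => x; apply/existsP/existsP => -[u /andP[vu ux]].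
  by exists (g u); rewrite -ev gK vu -lab'E gK.
by exists (f u); rewrite ev vu lab'E.
Qed.

Lemma inbox_transport (st : V -> state A) (st' : V' -> state A) (v : V) :
  edge_preserving_on_ball 0 v -> (forall y, e v y -> st' (f y) = st y) ->
  inbox e' lab' st' (f v) = inbox e lab st v.
Proof.
move=> [ev _] stE; apply: funext => x; rewrite /inbox lab'E.
case: pickP => [u /andP[vu /eqP ux]|no_u];
  case: pickP => [y /andP[vy /eqP yx]|no_y] //=.
- have uE : u = f y by rewrite -[u]gK; congr f; apply: lab_inj; rewrite yx -ux -lab'E gK.
  by rewrite uE stE.
- by have := no_y (g u); rewrite -ev gK vu -lab'E gK ux eqxx.
- by have := no_u (f y); rewrite ev vy lab'E yx eqxx.
Qed.

Lemma run_transport (t : nat) (v : V) : edge_preserving_on_ball t v ->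
  run e' A lab' bits' t (f v) = run e A lab bits t v.
Proof.
elim: t v => [|t IH] v f_ball /=.
  by rewrite lab'E bits'E neighbor_labels_transport.
have [ev nv] := f_ball; rewrite IH; last exact: edge_preserving_on_ballW.
by congr receive; apply: inbox_transport => // y /nv/IH.
Qed.

End Locality.

Section SegmentReversal.
Variables n c d : nat.

(* [insubd x] fixes the positions whose mirror image falls outside ['I_n], so that
   this is an involution even when [n <= d]. *)
Definition segment_reversal_fun (x : 'I_n) : 'I_n :=
  if (c <= x <= d)%N then insubd x (c + d - x)%N else x.

Lemma val_segment_reversal_fun (x : 'I_n) :
  segment_reversal_fun x =
  (if (c <= x <= d) && (c + d - x < n) then c + d - x else x)%N :> nat.
Proof.
rewrite /segment_reversal_fun; case: (c <= x <= d)%N => //=.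
by rewrite val_insubd.
Qed.

Lemma segment_reversal_funK : involutive segment_reversal_fun.
Proof.
move=> x; apply: val_inj; rewrite /= !val_segment_reversal_fun.
by have := ltn_ord x; do 2?case: ifP; lia.
Qed.

Definition segment_reversal : {perm 'I_n} := perm (inv_inj segment_reversal_funK).

Hypothesis d_lt : (d < n)%N.

Lemma val_segment_reversal (x : 'I_n) :
  segment_reversal x = (if (c <= x <= d)%N then c + d - x else x)%N :> nat.
Proof.
by rewrite permE val_segment_reversal_fun; do 2?case: ifP; lia.
Qed.

Lemma segment_reversal_on_ball (t : nat) (v : 'I_n) :
  (v + t + 2 <= c)%N || (c + t < v)%N && (v + t < d)%N ->
  edge_preserving_on_ball (@path_edge n) (@path_edge n) segment_reversal t v.
Proof.
have edgeE (x y : 'I_n) : (x + 2 <= c)%N || (c < x)%N && (x < d)%N ->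
    path_edge (segment_reversal x) (segment_reversal y) = path_edge x y.
  by rewrite /path_edge !val_segment_reversal; do 2?case: ifP; lia.
elim: t v => [|t IH] v vt; first by split=> // y; apply: edgeE; lia.
split=> [y|y vy]; first by apply: edgeE; lia.
by apply: IH; move: vy; rewrite /path_edge; lia.
Qed.

End SegmentReversal.

Section Uncovered.
Variables (n : nat) (S : {set 'I_n.+1}).

Definition uncovered (i : nat) : bool := (inord i \notin S) && (inord i.+1 \notin S).

Definition uncovered_edges (u v : nat) : nat := (\sum_(u <= i < v) uncovered i)%N.

Definition agree (u v : nat) : bool := (inord u \in S) == (inord v \in S).

Lemma leq_sum_uncovered_blocks (B J : nat) : (J * B <= n)%N ->
  (\sum_(0 <= j < J) uncovered_edges (j * B) (j.+1 * B) <= uncovered_edges 0 n)%N.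
Proof.
move=> JB; rewrite -big_nat_mul /uncovered_edges.
by rewrite [leqRHS](big_cat_nat (n := J * B)) ?leq_addr.
Qed.

Hypothesis indS : independent (@path_edge n.+1) S.

Lemma independent_edge_sum (i : nat) : (i < n)%N ->
  ((inord i \in S) + (inord i.+1 \in S) + uncovered i)%N = 1%N.
Proof.
move=> i_n; rewrite /uncovered.
case iS: (inord i \in S); case i1S: (inord i.+1 \in S) => //.
move/'forall_in_forall_inP: indS => /(_ _ iS _ i1S).
by rewrite /path_edge !inordK ?eqxx//; lia.
Qed.

Lemma card_uncovered_edges : (2 * #|S| + uncovered_edges 0 n <= n.+2)%N.
Proof.
pose x i : nat := inord i \in S.
have cardS : #|S| = (\sum_(0 <= i < n.+1) x i)%N.
  rewrite -sum1_card big_mkcond /= big_mkord; apply: eq_bigr => i _.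
  by rewrite /x inord_val; case: (i \in S).
have: (\sum_(0 <= i < n) (x i + x i.+1 + uncovered i) = n)%N.
  rewrite -[RHS](subn0 n) -[RHS]muln1 -sum_nat_const_nat.
  by apply: eq_big_nat => i /andP[_]; exact: independent_edge_sum.
rewrite !big_split /= -/(uncovered_edges 0 n).
have := cardS; rewrite big_nat_recr //=; have := cardS; rewrite big_nat_recl //=.
have := leq_b1 (inord 0 \in S); have := leq_b1 (inord n \in S).
rewrite -/(x 0%N) -/(x n); lia.
Qed.

Lemma alternating_segment (u m : nat) : (u + m <= n)%N ->
  uncovered_edges u (u + m) = 0%N ->
  (inord (u + m) \in S) = (inord u \in S) (+) odd m.
Proof.
elim: m => [|m IH] um; first by rewrite addn0 addbF.
rewrite addnS in um *; rewrite /uncovered_edges big_nat_recr ?leq_addr//=.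
move=> /eqP; rewrite addn_eq0 => /andP[/eqP/(IH (ltnW um)) um_alt /eqP covered].
have := independent_edge_sum um; rewrite covered um_alt addn0 addbN.
by case: (inord (u + m).+1 \in S); case: (_ (+) _).
Qed.

Lemma leq_agree_uncovered_edges (u m : nat) : ~~ odd m -> (u + m < n)%N ->
  (1 + agree u (u + m).+1 <= agree u (u + m) + 2 * uncovered_edges u (u + m).+1)%N.
Proof.
move=> m_even um; have [all_covered|] := posnP (uncovered_edges u (u + m).+1); last first.
  by case: (agree _ _) (agree _ _) => -[]; lia.
have /andP[/eqP init_covered _] :
    (uncovered_edges u (u + m) == 0)%N && (uncovered (u + m) == 0 :> nat)%N.
  by rewrite -addn_eq0 -[X in X == _]big_nat_recr ?leq_addr//=; exact/eqP.
rewrite /agree (alternating_segment (ltnW um) init_covered) -addnS.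
rewrite alternating_segment ?addnS//= (negbTE m_even) addbF eqxx.
by case: (_ \in S).
Qed.

End Uncovered.

Lemma card_le_alpha_bipartite (V : finType) (e : rel V) (color : pred V) :
  (forall u v, e u v -> color u != color v) -> (#|V| <= 2 * alpha e)%N.
Proof.
move=> e_color.
have class_le (b : bool) : (#|[set v | color v == b]%SET| <= alpha e)%N.
  apply: leq_bigmax_cond; apply/'forall_in_forall_inP => u; rewrite inE => /eqP ub v.
  by rewrite inE => /eqP vb; apply: contraTN isT => /e_color; rewrite ub vb eqxx.
rewrite mul2n -addnn -(cardsC [set v | color v == true]%SET).
apply: leq_add => //; rewrite (_ : ~: _ = [set v | color v == false]%SET)%SET//.
by apply/setP => v; rewrite !inE; case: (color v).
Qed.

Lemma leq_alpha_path (n : nat) : (n <= 2 * alpha (@path_edge n))%N.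
Proof.
rewrite -{1}[n]card_ord; apply: (@card_le_alpha_bipartite _ _ (fun v : 'I_n => odd v)).
by move=> u v /orP[] /eqP <- /=; case: (odd _).
Qed.

(* [g_sigma_algebraType] requires a pointed carrier. *)
HB.instance Definition _ (T : finType) := isPointed.Build (perm_type T) (1%g : {perm T}).

Section InputSpace.
Variable n : nat.

Definition bit_events : set_system ('I_n -> nat -> bool) :=
  [set C | exists v k, C = [set bits : 'I_n -> nat -> bool | bits v k]].

Definition input : Type := ({perm 'I_n} * ('I_n -> nat -> bool))%type.

Definition input_cylinder (s : {perm 'I_n}) (K : nat) (a : 'I_n -> nat -> bool) :
    set input :=
  [set x | x.1 = s /\ forall v k, (k < K)%N -> x.2 v k = a v k].

Definition input_cylinders : set_system input :=
  [set C | C = set0 \/ exists s K a, C = input_cylinder s K a].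

Definition input_space : measurableType input_cylinders.-sigma :=
  g_sigma_algebraType input_cylinders.

Lemma measurable_input_cylinder (s : {perm 'I_n}) (K : nat) (a : 'I_n -> nat -> bool) :
  measurable (input_cylinder s K a : set input_space).
Proof. by apply: sub_sigma_algebra; right; exists s, K, a. Qed.

Lemma setI_closed_input_cylinders : setI_closed input_cylinders.
Proof.
move=> _ _ [->|[s [K [a ->]]]] [->|[s' [K' [a' ->]]]]; rewrite ?set0I ?setI0; try by left.
have [->|/set0P[x [[xs xa] [xs' xa']]]] :=
  eqVneq (input_cylinder s K a `&` input_cylinder s' K' a') set0; first by left.
right; exists s, (maxn K K'), x.2; apply/seteqP; split=> [y [[ys ya] [_ ya']]|y [ys yx]].
  split=> // v k; rewrite leq_max => /orP[] kK.
    by rewrite (ya _ _ kK) (xa _ _ kK).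
  by rewrite (ya' _ _ kK) (xa' _ _ kK).
split; split=> [|v k kK]; rewrite ?ys -?xs//.
  by rewrite yx ?xa// leq_max kK.
by rewrite yx ?xa'// leq_max kK orbT.
Qed.

Lemma measurable_label (s : {perm 'I_n}) : measurable [set x : input_space | x.1 = s].
Proof.
rewrite (_ : [set x | _] = input_cylinder s 0 (fun _ _ => true)).
  exact: measurable_input_cylinder.
by apply/seteqP; split=> x; [split|case].
Qed.

Lemma measurable_input_bit (v : 'I_n) (k : nat) :
  measurable [set x : input_space | x.2 v k].
Proof.
pose ext (q : {ffun 'I_n * 'I_k.+1 -> bool}) (u : 'I_n) (i : nat) := q (u, inord i).
rewrite (_ : [set x | _] =
  \bigcup_(p in [set p | ext p.2 v k]) input_cylinder p.1 k.+1 (ext p.2)).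
  apply: fin_bigcup_measurable => [|p _]; first exact: finite_finset.
  exact: measurable_input_cylinder.
apply/seteqP; split=> [x xk|x [p /= pk] [_ xp]]; last by rewrite /= xp.
exists (x.1, [ffun p : 'I_n * 'I_k.+1 => x.2 p.1 p.2]) => /=.
  by rewrite /ext ffunE /= inordK.
by split=> //= u i ik; rewrite /ext ffunE /= inordK.
Qed.

Lemma measurable_input_bits (C : set ('I_n -> nat -> bool)) :
  measurable_bits C -> measurable [set x : input_space | C x.2].
Proof.
move=> mC; rewrite -[[set x | _]]setTI.
pose bit_space := g_sigma_algebraType bit_events.
suff m_snd : measurable_fun [set: input_space] (snd : input_space -> bit_space).
  exact: m_snd measurableT C mC.
apply: (@measurability _ _ _ bit_space _ _ bit_events) => // _ [_ [v [k ->]] <-].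
by rewrite setTI; exact: measurable_input_bit.
Qed.

Lemma measurable_mem_path_output (A : local_algorithm) (T : nat) (v : 'I_n) :
  measurable_output n A T ->
  measurable_fun setT (fun x : input_space => v \in path_output A T x.1 x.2).
Proof.
move=> mA; apply: (measurable_fun_bool true); rewrite setTI.
rewrite (_ : _ @^-1` _ = \bigcup_(s in [set: {perm 'I_n}])
    ([set x | x.1 = s] `&` [set x | v \in path_output A T s x.2])).
  apply: fin_bigcup_measurable => [|s _]; first exact: finite_finset.
  apply: measurableI; first exact: measurable_label.
  exact: measurable_input_bits (mA s v).
by apply/seteqP; split=> [x vx|x [s _ [/= <-]]//]; exists x.1.
Qed.

Lemma measurable_path_output (A : local_algorithm) (T : nat) (S : {set 'I_n}) :
  measurable_output n A T ->
  measurable [set x : input_space | path_output A T x.1 x.2 = S].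
Proof.
move=> mA; rewrite (_ : [set x | _] = \bigcap_(v in [set: 'I_n])
    (fun x => v \in path_output A T x.1 x.2) @^-1` [set (v \in S)]).
  apply: fin_bigcap_measurable => [|v _]; first exact: finite_finset.
  by rewrite -[_ @^-1` _]setTI; exact: measurable_mem_path_output.
by apply/seteqP; split=> [x /= <-//|x xS]; apply/setP => v; exact: xS.
Qed.

End InputSpace.

Section RandomInput.
Context (R : realType) (d : measure_display) (W : measurableType d)
  (P : probability W R) (n : nat).
Implicit Types (L : W -> {perm 'I_n}) (b : W -> 'I_n -> nat -> bool).

Definition random_input L b (w : W) : input_space n := (L w, b w).

Lemma measurable_random_input L b :
  uniform_labelling_and_bits P L b -> measurable_fun setT (random_input L b).
Proof.
move=> [mL mb _].
apply: (@measurability _ _ _ (input_space n) _ _ (@input_cylinders n)) => //.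
move=> _ [_ [->|[s [K [a ->]]]] <-]; rewrite setTI ?preimage_set0//.
have m_bit v k : measurable_fun setT (fun w => b w v k).
  by apply: (measurable_fun_bool true); rewrite setTI; exact: mb.
rewrite (_ : _ @^-1` _ = [set w | L w = s] `&` \bigcap_(p in [set: 'I_n * 'I_K])
  (fun w => b w p.1 p.2) @^-1` [set a p.1 p.2]).
  apply: measurableI; first exact: mL.
  apply: fin_bigcap_measurable => [|p _]; first exact: finite_finset.
  by rewrite -[_ @^-1` _]setTI; exact: m_bit.
apply/seteqP; split=> w [Lw bw]; split=> //; first by move=> p _; exact: bw.
by move=> v k kK; exact: (bw (v, Ordinal kK)).
Qed.

Lemma random_input_cylinderE L b s K a : uniform_labelling_and_bits P L b ->
  P (random_input L b @^-1` input_cylinder s K a) = ((n`!)%:R^-1 * 2^-1 ^+ (n * K))%:E.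
Proof. by case=> _ _; exact. Qed.

Lemma random_input_law_unique L b L' b' (E : set (input_space n)) :
  uniform_labelling_and_bits P L b -> uniform_labelling_and_bits P L' b' ->
  measurable E -> P (random_input L b @^-1` E) = P (random_input L' b' @^-1` E).
Proof.
move=> ub ub' mE.
pose Y : {mfun W >-> input_space n} := mfun_Sub (mem_set (measurable_random_input ub)).
pose Y' : {mfun W >-> input_space n} := mfun_Sub (mem_set (measurable_random_input ub')).
pose cover i := input_cylinder (nth 1%g (enum {: {perm 'I_n}}) i) 0 (fun _ _ => true).
rewrite -[LHS]/(distribution P Y E) -[RHS]/(distribution P Y' E).
apply: (@g_sigma_algebra_measure_unique _ R (input_space n) (@input_cylinders n) _ cover)
  => //.
- exact: sub_sigma_algebra.
- by move=> i; right; eexists; eexists; eexists.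
- rewrite -subTset => x _; exists (index x.1 (enum {: {perm 'I_n}})) => //.
  by split=> //; rewrite nth_index// mem_enum.
- exact: setI_closed_input_cylinders.
- move=> _ [->|[s [K [a ->]]]]; rewrite ?measure0//=.
  by rewrite /distribution /pushforward !random_input_cylinderE.
- by move=> i /=; rewrite /distribution /pushforward random_input_cylinderE ?ltry.
Qed.

Definition relabel (f : {perm 'I_n}) (x : input_space n) : input_space n :=
  ((f^-1 * x.1)%g, fun v => x.2 (f^-1%g v)).

Lemma uniform_labelling_and_bits_perm L b (f : {perm 'I_n}) :
  uniform_labelling_and_bits P L b ->
  uniform_labelling_and_bits P (fun w => (f^-1 * L w)%g) (fun w v => b w (f^-1%g v)).
Proof.
move=> [mL mb law]; split=> [s|v k|s K a].
- rewrite (_ : [set w | _] = [set w | L w = (f * s)%g]); first exact: mL.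
  by apply/seteqP; split=> w /= => [<-|->]; rewrite ?mulKVg ?mulKg.
- exact: mb.
- rewrite -(law (f * s)%g K (fun v => a (f v))); congr (P _).
  apply/seteqP; split=> w /= [Lw bw]; split=> [|v k kK].
  + by rewrite -Lw mulKVg.
  + by rewrite -bw// permK.
  + by rewrite Lw mulKg.
  + by rewrite bw// permKV.
Qed.

Lemma random_input_relabel L b (f : {perm 'I_n}) (E : set (input_space n)) :
  uniform_labelling_and_bits P L b -> measurable E ->
  P [set w | E (relabel f (random_input L b w))] = P [set w | E (random_input L b w)].
Proof.
by move=> ub; exact: random_input_law_unique (uniform_labelling_and_bits_perm f ub) ub.
Qed.

End RandomInput.

Lemma path_output_relabel (n : nat) (A : local_algorithm) (T : nat) (f : {perm 'I_n})
    (x : input_space n) (v : 'I_n) :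
  edge_preserving_on_ball (@path_edge n) (@path_edge n) f T v ->
  (f v \in path_output A T (relabel f x).1 (relabel f x).2) =
  (v \in path_output A T x.1 x.2).
Proof.
move=> f_ball; rewrite !inE; congr output; apply: run_transport f_ball.
- exact: (permKV f).
- by move=> y z [] /val_inj/perm_inj.
- by move=> y; rewrite /label_of permM permK.
- by move=> y; rewrite /= permK.
Qed.

Section FiniteValued.
Context (R : realType) (d : measure_display) (W : measurableType d)
  (P : probability W R) (F : finType) (X : W -> F).

Definition mean (h : F -> R) : R := \int[P]_w h (X w).

Hypothesis mX : forall x, measurable [set w | X w = x].

Lemma measurable_event_finite_valued (Q : set F) : measurable [set w | Q (X w)].
Proof.
rewrite (_ : [set w | _] = \bigcup_(x in Q) [set w | X w = x]).
  by apply: fin_bigcup_measurable => //; exact: finite_finset.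
by apply/seteqP; split=> [w Qw|w [x Qx /= ->]//]; exists (X w).
Qed.

Lemma measurable_finite_valued (d' : measure_display) (U : measurableType d') (h : F -> U) :
  measurable_fun setT (h \o X).
Proof.
by move=> _ B _; rewrite setTI; exact: (measurable_event_finite_valued (h @^-1` B)).
Qed.

Lemma integrable_finite_valued (h : F -> R) : P.-integrable setT (EFin \o (h \o X)).
Proof.
apply: measurable_bounded_integrable => //.
- by rewrite ltey_eq fin_num_measure.
- exact: measurable_finite_valued.
- exists (\sum_x `|h x|); split=> [|M hM w _ /=]; first exact: num_real.
  by apply: le_trans (ltW hM); rewrite (bigD1 (X w))//= lerDl sumr_ge0.
Qed.

Lemma expectation_mean (h : F -> R) : ('E_P[h \o X] = (mean h)%:E)%E.
Proof.
rewrite expectation.unlock /mean /Rintegral fineK//.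
exact: integrable_fin_num (integrable_finite_valued h).
Qed.

Lemma mean_cst (c : R) : mean (fun=> c) = c.
Proof. by apply: EFin_inj; rewrite -expectation_mean; exact: expectation_cst. Qed.

Lemma meanD (h1 h2 : F -> R) : mean (fun x => h1 x + h2 x) = mean h1 + mean h2.
Proof. by rewrite /mean RintegralD//; exact: integrable_finite_valued. Qed.

Lemma meanZl (c : R) (h : F -> R) : mean (fun x => c * h x) = c * mean h.
Proof. by rewrite /mean RintegralZl//; exact: integrable_finite_valued. Qed.

Lemma mean_sum (I : Type) (r : seq I) (h : I -> F -> R) :
  mean (fun x => \sum_(i <- r) h i x) = \sum_(i <- r) mean (h i).
Proof.
elim: r => [|i r IH].
  by rewrite big_nil -[RHS]mean_cst; congr mean; apply: funext => x; rewrite big_nil.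
by rewrite big_cons -IH -meanD; congr mean; apply: funext => x; rewrite big_cons.
Qed.

Lemma mean_pred (Q : pred F) : mean (fun x => (Q x)%:R) = fine (P [set w | Q (X w)]).
Proof.
rewrite -(expectation_indic P (measurable_event_finite_valued Q)) expectation.unlock.
by congr fine; apply: eq_integral => w _; rewrite indicE mem_setE.
Qed.

Lemma le_mean_ae (h1 h2 : F -> R) :
  {ae P, forall w, h1 (X w) <= h2 (X w)} -> mean h1 <= mean h2.
Proof.
move=> h12; pose h x := Num.min (h1 x) (h2 x); have -> : mean h1 = mean h.
  congr fine; apply: ae_eq_integral => //.
  - exact/measurable_EFinP/measurable_finite_valued.
  - exact/measurable_EFinP/(measurable_finite_valued h).
  - by apply: filterS h12 => w w12 _; rewrite /h min_l.
apply: le_Rintegral => // [||w _]; last by rewrite ge_min lexx orbT.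
- exact: (integrable_finite_valued h).
- exact: (integrable_finite_valued h2).
Qed.

End FiniteValued.

Section RandomIndependentSet.
Context (R : realType) (d : measure_display) (W : measurableType d)
  (P : probability W R) (n : nat) (X : W -> {set 'I_n.+1}).
Hypothesis mX : forall S, measurable [set w | X w = S].
Hypothesis indX : {ae P, forall w, independent (@path_edge n.+1) (X w)}.

Lemma mean_uncovered_edges_ge (u m : nat) : ~~ odd m -> (u + m < n)%N ->
  P [set w | agree (X w) u (u + m)] = P [set w | agree (X w) u (u + m).+1] ->
  1 <= 2 * mean P X (fun S => (uncovered_edges S u (u + m).+1)%:R).
Proof.
move=> m_even um agreeE.
have: mean P X (fun S => 1 + (agree S u (u + m).+1)%:R) <=
    mean P X (fun S => (agree S u (u + m))%:R + 2 * (uncovered_edges S u (u + m).+1)%:R).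
  apply: le_mean_ae => //; apply: filterS indX => w indXw.
  by rewrite -natrM -natrD nat1r ler_nat; exact: leq_agree_uncovered_edges.
by rewrite !meanD// meanZl// mean_cst// !mean_pred// agreeE; lra.
Qed.

Lemma mean_card_uncovered_edges :
  2 * mean P X (fun S => #|S|%:R) + mean P X (fun S => (uncovered_edges S 0 n)%:R) <=
  n.+2%:R.
Proof.
rewrite -meanZl// -meanD// -[leRHS](mean_cst P mX); apply: le_mean_ae => //.
apply: filterS indX => w /card_uncovered_edges.
by rewrite -(ler_nat R) natrD natrM.
Qed.

Lemma mean_card_le (B J : nat) : (J * B <= n)%N ->
  (forall j, (j < J)%N ->
    1 <= 2 * mean P X (fun S => (uncovered_edges S (j * B) (j.+1 * B))%:R)) ->
  4 * mean P X (fun S => #|S|%:R) + J%:R <= 2 * n.+2%:R.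
Proof.
move=> JB block_ge.
have : mean P X (fun S => \sum_(0 <= j < J) (uncovered_edges S (j * B) (j.+1 * B))%:R) <=
    mean P X (fun S => (uncovered_edges S 0 n)%:R).
  apply: le_mean_ae => //; apply: aeW => w.
  by rewrite -natr_sum ler_nat; exact: leq_sum_uncovered_blocks.
have : J%:R <= 2 * \sum_(0 <= j < J)
    mean P X (fun S => (uncovered_edges S (j * B) (j.+1 * B))%:R).
  rewrite mulr_sumr -[J in J%:R]subn0 -sumr_const_nat big_nat [leRHS]big_nat.
  by apply: ler_sum => j /andP[_]; exact: block_ge.
rewrite mean_sum//; have := mean_card_uncovered_edges; lra.
Qed.

End RandomIndependentSet.

Section RandomOutput.
Context (R : realType) (d : measure_display) (W : measurableType d)
  (P : probability W R) (n : nat) (A : local_algorithm) (T : nat)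
  (L : W -> {perm 'I_n.+1}) (b : W -> 'I_n.+1 -> nat -> bool).
Hypotheses (mA : measurable_output n.+1 A T) (ub : uniform_labelling_and_bits P L b).

Let X w := path_output A T (L w) (b w).

Lemma measurable_random_output (S : {set 'I_n.+1}) : measurable [set w | X w = S].
Proof.
rewrite -[[set w | _]]setTI.
exact: (measurable_random_input ub measurableT (measurable_path_output S mA)).
Qed.

(* Reversing the positions from [u + T + 3] to [u + 3T + 6] moves no node within
   distance [T + 1] of [u] and carries the view of the node at [u + 2T + 4] to
   that of its successor. *)
Lemma probability_agree_succ (u : nat) : (u + 3 * T + 6 <= n)%N ->
  P [set w | agree (X w) u (u + (2 * T + 4))] =
  P [set w | agree (X w) u (u + (2 * T + 4)).+1].
Proof.
rewrite -ltnS => d_lt; set v := (u + (2 * T + 4))%N.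
pose f := segment_reversal n.+1 (u + T + 3) (u + 3 * T + 6).
have fu : f (inord u) = inord u.
  by apply: val_inj; rewrite /= val_segment_reversal// inordK; [case: ifP|]; lia.
have fv : f (inord v) = inord v.+1.
  by apply: val_inj; rewrite /= val_segment_reversal// !inordK; [case: ifP| |]; lia.
pose E := [set x : input_space n.+1 | agree (path_output A T x.1 x.2) u v.+1].
have mE : measurable E.
  exact: (measurable_event_finite_valued (fun S => measurable_path_output S mA)
    (fun S => agree S u v.+1)).
rewrite -[RHS](random_input_relabel f ub mE); congr (P _); apply: funext => w.
rewrite /E /mkset /agree -fv -{2}fu !path_output_relabel//.
all: by apply: segment_reversal_on_ball => //; rewrite inordK; lia.
Qed.

Hypothesis indX : {ae P, forall w, independent (@path_edge n.+1) (X w)}.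

Lemma mean_card_path_output_le (J : nat) : (J * (2 * T + 5) <= n - T.+1)%N ->
  4 * mean P X (fun S => #|S|%:R) + J%:R <= 2 * n.+2%:R.
Proof.
have mX := measurable_random_output; set B := (2 * T + 5)%N => JB.
apply: (mean_card_le mX indX (B := B)) => [|j jJ]; first by lia.
have jB : (j * B + B <= J * B)%N by rewrite addnC -mulSn leq_mul2r jJ orbT.
have -> : (j.+1 * B = (j * B + (2 * T + 4)).+1)%N by rewrite mulSn /B; lia.
apply: (mean_uncovered_edges_ge mX indX); try by lia.
by apply: probability_agree_succ; lia.
Qed.

Lemma expected_size_path_output_le :
  (expected_size P X <= (n.+1%:R / 2 + 1 - n.+1%:R / (4 * (2 * T%:R + 5)))%:E)%E.
Proof.
pose B := (2 * T + 5)%N; pose J := ((n - T.+1) %/ B)%N.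
have nJ : n.+1%:R / B%:R <= J%:R + 2 :> R.
  rewrite ler_pdivrMr ?ltr0n ?addn_gt0 ?orbT// -natrD -natrM ler_nat addn2 !mulSn.
  by have := @ltn_ceil (n - T.+1) B ltac:(lia); rewrite mulSn; lia.
rewrite /expected_size (expectation_mean P measurable_random_output (fun S => #|S|%:R)).
rewrite lee_fin invfM mulrCA -[2 * T%:R]natrM -natrD -/B.
have := mean_card_path_output_le (leq_trunc_div (n - T.+1) B).
by move: nJ; rewrite -/J -[n.+2%:R]natr1; lra.
Qed.

End RandomOutput.

Lemma rounds_ge_of_approx_factor (R : realFieldType) (eps N alphaN T : R) :
  0 < eps -> eps <= 1 / 40 -> 4 < N * eps -> 0 <= T -> N <= 2 * alphaN ->
  alphaN <= (1 + eps) * (N / 2 + 1 - N / (4 * (2 * T + 5))) ->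
  1 / 16 / eps <= T.
Proof.
move=> eps_gt0 eps_le N_gt T_ge0 alpha_ge approx.
rewrite leNgt; apply/negP; rewrite ltr_pdivlMr// => T_lt.
have N_gt0 : 0 < N by rewrite -(pmulr_lgt0 _ eps_gt0); lra.
have loss_ge : N * eps <= N / (4 * (2 * T + 5)).
  by rewrite ler_pM2l// -[leRHS]mul1r ler_pdivlMr; lra.
have : (1 + eps) * (N / 2 + 1 - N / (4 * (2 * T + 5))) <=
    (1 + eps) * (N / 2 + 1 - N * eps) by rewrite ler_pM2l; lra.
have : 0 < N * eps * eps by rewrite !mulr_gt0.
lra.
Qed.

Theorem theorem26 (R : realType) :
  exists c : R, 0 < c /\ exists eps0 : R, 0 < eps0 /\
  forall eps : R, 0 < eps -> eps <= eps0 ->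
  exists N : nat, forall n : nat, (N <= n)%N ->
  forall (A : local_algorithm) (T : nat), measurable_output n A T ->
  forall (d : measure_display) (W : measurableType d) (P : probability W R)
         (L : W -> {perm 'I_n}) (b : W -> 'I_n -> nat -> bool),
    uniform_labelling_and_bits P L b ->
    {ae P, forall w, independent (@path_edge n) (path_output A T (L w) (b w))} ->
    expected_approx_factor_le P (fun w => path_output A T (L w) (b w)) (1 + eps) ->
    c / eps <= T%:R.
Proof.
exists (1 / 16); split; first by lra.
exists (1 / 40); split => [|eps eps_gt0 eps_le]; first by lra.
exists (Num.truncn (4 / eps)).+1 => -[//|n] n_ge A T mA d W P L b ub indX approx.
have n_gt : 4 < n.+1%:R * eps.
  by rewrite -ltr_pdivrMr//; apply: lt_le_trans (truncnS_gt _) _; rewrite ler_nat.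
have alpha_ge : n.+1%:R <= 2 * (alpha (@path_edge n.+1))%:R :> R.
  by rewrite -natrM ler_nat; exact: leq_alpha_path.
apply: (rounds_ge_of_approx_factor eps_gt0 eps_le n_gt _ alpha_ge _) => //.
rewrite -lee_fin EFinM; apply: le_trans approx _.
rewrite lee_pmul2l// ?lte_fin ?addr_gt0//.
exact: expected_size_path_output_le.
Qed.
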